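(* Let $\rho>0$, let $\mathcal X,\mathcal Y,\mathcal M_1,\mathcal M_2$ be finite nonempty sets, and let $(X,Y)$ be drawn from $\mathcal X\times\mathcal Y$ according to the PMF $P_{X,Y}$. Put $\tilde\rho=1/(1+\rho)$. For an encoder (a conditional PMF of $(M_1,M_2)\in\mathcal M_1\times\mathcal M_2$ given $(X,Y)$), let $\mathscr A_{\mathrm B}^{(\mathrm g)}(P_{X,Y})$ and $\mathscr A_{\mathrm E}(P_{X,Y})$ be Bob's guessing ambiguity and Eve's ambiguity as defined in the context. (Direct part.) For every triple of positive integers $(c_s,c_1,c_2)$ satisfying $$c_s\le \min\{|\mathcal M_1|,|\mathcal M_2|\},\qquad c_1\le \lfloor |\mathcal M_1|/c_s\rfloor,\qquad c_2\le\lfloor |\mathcal M_2|/c_s\rfloor,$$ there is an encoder for which both $$\mathscr A_{\mathrm B}^{(\mathrm g)}(P_{X,Y})<1+2^{\rho\left(H_{\tilde\rho}(X|Y)-\log(c_sc_1c_2)+1\right)}$$ and $$\mathscr A_{\mathrm E}(P_{X,Y})\ge (1+\ln|\mathcal X|)^{-\rho}\,2^{\rho\left(H_{\tilde\rho}(X|Y)-\log(c_1+c_2)\right)} .$$ (Converse part.) For every encoder, $$\mathscr A_{\mathrm B}^{(\mathrm g)}(P_{X,Y})\ge \max\left\{(1+\ln|\mathcal X|)^{-\rho}\,2^{\rho\left(H_{\tilde\rho}(X|Y)-\log(|\mathcal M_1||\mathcal M_2|)\right)},\,1\right\}$$ and $$\mathscr A_{\mathrm E}(P_{X,Y})\le\min\left\{\min\{|\mathcal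 M_1|^\rho,|\mathcal M_2|^\rho\}\,\mathscr A_{\mathrm B}^{(\mathrm g)}(P_{X,Y}),\;2^{\rho H_{\tilde\rho}(X|Y)}\right\}.$$
   Context: Logarithms $\log$ are to base 2; $\ln$ is the natural logarithm. Encoder: a conditional PMF $\mathbb P[M_1=m_1,M_2=m_2\mid X=x,Y=y]$ on $\mathcal M_1\times\mathcal M_2$ for each $(x,y)\in\mathcal X\times\mathcal Y$; together with $P_{X,Y}$ it determines the joint law of $(X,Y,M_1,M_2)$. Guessing function: for side information $W$ taking values in a finite set $\mathcal W$, a guessing function $G(\cdot|W)$ for $X$ is a choice, for each $w\in\mathcal W$, of a bijection $G(\cdot|w):\mathcal X\to\{1,\dots,|\mathcal X|\}$. Bob's ambiguity (guessing version): $\mathscr A_{\mathrm B}^{(\mathrm g)}(P_{X,Y})=\min_G \mathbb E[G(X|Y,M_1,M_2)^\rho]$, the minimum being over guessing functions with side information $(Y,M_1,M_2)$. Eve's ambiguity: $\mathscr A_{\mathrm E}(P_{X,Y})=\min_{G_1,G_2}\mathbb E\left[\min\{G_1(X|Y,M_1)^\rho,\,G_2(X|Y,M_2)^\rho\}\right]$, the outer minimum being over guessing functions $G_1$ with side information $(Y,M_1)$ and $G_2$ with side information $(Y,M_2)$. Conditional Rényi entropy (Arimoto) of order $\alpha\in(0,1)$: $H_\alpha(X|Y)=\frac{\alpha}{1-\alpha}\log\sum_{y\in\mathcal Y}\left(\sum_{x\in\mathcal X}P_{X,Y}(x,y)^\alpha\right)^{1/\alpha}$. *)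

(* Defs.v *)
From HB Require Import structures.
From mathcomp Require Import all_boot all_order all_algebra.
From mathcomp Require Import boolp reals exp.
Set Implicit Arguments.
Unset Strict Implicit.
Unset Printing Implicit Defensive.
Import Order.TTheory GRing.Theory Num.Theory.
Local Open Scope ring_scope.

Section Pmf.
Variable R : realType.

Definition log2 (x : R) : R := ln x / ln 2.

Definition is_pmf (T : finType) (p : T -> R) : Prop :=
  (forall t, 0 <= p t) /\ \sum_t p t = 1.

Definition expectation (T : finType) (p f : T -> R) : R :=
  \sum_t p t * f t.

(* \min_t F t; the default F t0 is itself one of the values of F. *)
Definition fin_min (T : finType) (t0 : T) (F : T -> R) : R :=
  \big[Num.min/F t0]_t F t.

(* Arimoto's conditional Rényi entropy. *)
Definition renyi (X Y : finType) (alpha : R) (P : X * Y -> R) : R :=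
  alpha / (1 - alpha) *
  log2 (\sum_y (\sum_x P (x, y) `^ alpha) `^ alpha^-1).

End Pmf.

Section Guessing.
Variables (X W : finType).

(* Guesses are numbered from 0 in 'I_#|X|; rank below shifts them to
   1, ..., #|X|. *)
Definition is_guessing (G : {ffun W -> {ffun X -> 'I_#|X|}}) : bool :=
  `[< forall w, bijective (G w) >].

Record guessing := Guessing {
  guess :> {ffun W -> {ffun X -> 'I_#|X|}};
  _ : is_guessing guess }.

HB.instance Definition _ := [isSub for guess].
HB.instance Definition _ := [Finite of guessing by <:].

Definition rank (G : guessing) (x : X) (w : W) : nat := (G w x).+1.

Lemma is_guessing_enum_rank :
  is_guessing [ffun _ => [ffun x => enum_rank x]].
Proof.
apply/asboolP => w; rewrite ffunE.
by apply: (eq_bij (@enum_rank_bij X)) => x; rewrite ffunE.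
Qed.

Definition enum_guessing : guessing := Guessing is_guessing_enum_rank.

End Guessing.

Section Ambiguity.
Variables (R : realType) (X Y M1 M2 : finType).

Definition is_encoder (Q : X * Y -> M1 * M2 -> R) : Prop :=
  forall xy, is_pmf (Q xy).

Definition joint (P : X * Y -> R) (Q : X * Y -> M1 * M2 -> R)
  (t : (X * Y) * (M1 * M2)) : R := P t.1 * Q t.1 t.2.

Definition ambiguityB (rho : R) (P : X * Y -> R)
    (Q : X * Y -> M1 * M2 -> R) : R :=
  fin_min (enum_guessing X (Y * M1 * M2)%type) (fun G =>
    expectation (joint P Q) (fun '((x, y), (m1, m2)) =>
      (rank G x (y, m1, m2))%:R `^ rho)).

Definition ambiguityE (rho : R) (P : X * Y -> R)
    (Q : X * Y -> M1 * M2 -> R) : R :=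
  fin_min (enum_guessing X (Y * M1)%type, enum_guessing X (Y * M2)%type)
    (fun '(G1, G2) =>
      expectation (joint P Q) (fun '((x, y), (m1, m2)) =>
        Num.min ((rank G1 x (y, m1))%:R `^ rho)
                ((rank G2 x (y, m2))%:R `^ rho))).

End Ambiguity.

(* Main.v *)
Require Import Defs.
From mathcomp Require Import all_boot all_order all_algebra.
From mathcomp Require Import boolp reals exp.
From mathcomp Require Import zify ring.
Import Order.TTheory GRing.Theory Num.Theory.
Set Implicit Arguments.
Unset Strict Implicit.
Local Open Scope ring_scope.

(* Put S = 2 ^ (rho * H).  Guessing in order of decreasing P(., y) costs at most
   S (Arikan).  Conversely, Hölder's inequality gives S <= K ^ rho * E[L ^ rho]
   as soon as the reciprocals 1 / L sum to at most K for each y; the reciprocals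
   of the ranks of one guessing order sum to at most 1 + ln |X|, so with side
   information K counts the guessing orders in play.

   Direct part: describe x by its optimal rank modulo cs * c1 * c2, read as a
   triple (vs, v1, v2), and send M1 = (vs + u, v1), M2 = (u, v2) with u uniform on
   Z/cs.  Bob recovers the triple, which divides his rank by cs * c1 * c2 up to
   rounding.  For Eve, keep u as an additional variable: since u and vs + u both
   range over Z/cs for fixed x, 1 / min(L1, L2) <= 1 / L1 + 1 / L2 sums over (x, u)
   to at most cs * (c1 + c2) * (1 + ln |X|), and the factor cs cancels against the
   1 / cs in the law of u.

   Converse part, comparison of Eve with Bob: knowing M1 only, guess x in order of
   its best rank over all values of M2, which multiplies ranks by at most |M2|. *)

(** * Hölder's inequality and harmonic sums *)

Lemma le_powR2 (R : realType) (a x y : R) :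
  0 <= a -> 0 <= x -> x <= y -> x `^ a <= y `^ a.
Proof.
by move=> a0 x0 xy; rewrite ge0_ler_powR ?nnegrE // (le_trans x0).
Qed.

(** Young's inequality is applied term by term after dividing [u] and [v] by their totals, then
    summed. A zero total is treated apart: every term vanishes. *)
Lemma hoelder_sum (R : realType) (T : finType) (u v : T -> R) (a b : R) :
  (forall t, 0 <= u t) -> (forall t, 0 <= v t) ->
  0 < a -> 0 < b -> a + b = 1 ->
  \sum_t u t `^ a * v t `^ b <= (\sum_t u t) `^ a * (\sum_t v t) `^ b.
Proof.
move=> u0 v0 a0 b0 ab1.
have zero_sum (w : T -> R) c : (forall t, 0 <= w t) -> 0 < c -> \sum_t w t = 0 ->
    forall t, w t `^ c = 0.
  move=> w0 c0 sw t; rewrite (psumr_eq0P _ sw) ?powR0 ?gt_eqF //.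
have /orP[/eqP su|su] : (\sum_t u t == 0) || (0 < \sum_t u t).
- by rewrite eq_sym -le_eqVlt sumr_ge0.
- rewrite big1 ?mulr_ge0 ?powR_ge0 // => t _.
  by rewrite (zero_sum u) ?mul0r.
have /orP[/eqP sv|sv] : (\sum_t v t == 0) || (0 < \sum_t v t).
- by rewrite eq_sym -le_eqVlt sumr_ge0.
- rewrite big1 ?mulr_ge0 ?powR_ge0 // => t _.
  by rewrite (zero_sum v) ?mulr0.
set A := \sum_t u t in su *; set B := \sum_t v t in sv *.
have young t : u t `^ a * v t `^ b <=
    (A `^ a * B `^ b) * (a / A * u t + b / B * v t).
  (* The conjugate exponents are 1 / a and 1 / b, so the powers on the right collapse to u / A and v
     / B. *)
  have := @conjugate_powR R ((u t / A) `^ a) ((v t / B) `^ b) a^-1 b^-1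
    (powR_ge0 _ _) (powR_ge0 _ _).
  rewrite !invr_gt0 !invrK => /(_ a0 b0 ab1).
  have [uA vB] : 0 <= u t / A /\ 0 <= v t / B.
    by split; rewrite divr_ge0 ?(ltW su) ?(ltW sv).
  rewrite -!powRrM (mulfV (lt0r_neq0 a0)) (mulfV (lt0r_neq0 b0)).
  rewrite (powRr1 uA) (powRr1 vB) => le_ab.
  have -> : u t `^ a * v t `^ b =
      (A `^ a * B `^ b) * ((u t / A) `^ a * (v t / B) `^ b).
    rewrite mulrACA -!powRM ?(ltW su) ?(ltW sv) //.
    by rewrite ![_ * (_ / _)]mulrC !divfK ?gt_eqF.
  rewrite ler_wpM2l ?mulr_ge0 ?powR_ge0 // (le_trans le_ab) //.
  by rewrite le_eqVlt; apply/orP; left; apply/eqP; ring.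
apply: (le_trans (ler_sum _ (fun t _ => young t))).
rewrite -mulr_sumr big_split /= -!mulr_sumr -/A -/B !divfK ?gt_eqF // ab1.
by rewrite mulr1.
Qed.

(** Hölder with exponents 1 / (1 + rho) and rho / (1 + rho) on the families p L^rho and 1 / L: in
    the product the powers of L cancel. *)
Lemma powR_sum_le (R : realType) (T : finType) (rho : R) (p L : T -> R) :
  0 < rho -> (forall t, 0 <= p t) -> (forall t, 0 < L t) ->
  (\sum_t p t `^ (1 / (1 + rho))) `^ (1 + rho) <=
  (\sum_t (L t)^-1) `^ rho * \sum_t p t * L t `^ rho.
Proof.
move=> rho0 p0 L0; set a := 1 / (1 + rho).
have r1 : 0 < 1 + rho by rewrite addr_gt0.
have a0 : 0 < a by rewrite divr_gt0.
have ra0 : 0 < rho * a by rewrite mulr_gt0.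
have A0 : 0 <= \sum_t p t * L t `^ rho.
  by apply: sumr_ge0 => t _; rewrite mulr_ge0 ?powR_ge0.
have B0 : 0 <= \sum_t (L t)^-1.
  by apply: sumr_ge0 => t _; rewrite invr_ge0 ltW.
have /= := @hoelder_sum R T (fun t => p t * L t `^ rho) (fun t => (L t)^-1)
  a (rho * a).
move=> /(_ _ _ a0 ra0 _) hol.
have {}hol : \sum_t p t `^ a <=
    (\sum_t p t * L t `^ rho) `^ a * (\sum_t (L t)^-1) `^ (rho * a).
  apply: le_trans (hol _ _ _).
  - apply: ler_sum => t _.
    rewrite powRM ?powR_ge0 // -powRrM -mulrA -powRM ?powR_ge0 //; last 2 first.
    + exact: ltW.
    + by rewrite invr_ge0 ltW.
    by rewrite mulfV ?gt_eqF // powR1 mulr1.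
  - by move=> t; rewrite mulr_ge0 ?powR_ge0.
  - by move=> t; rewrite invr_ge0 ltW.
  - by rewrite /a; field; rewrite gt_eqF.
have sum_ge0 : 0 <= \sum_t p t `^ a by rewrite sumr_ge0 // => t _; rewrite powR_ge0.
apply: (le_trans (le_powR2 (ltW r1) sum_ge0 hol)).
rewrite powRM ?powR_ge0 // -!powRrM -mulrA.
have -> : a * (1 + rho) = 1 by rewrite /a; field; rewrite gt_eqF.
by rewrite mulr1 powRr1 // mulrC.
Qed.

(** The induction step needs 1 / (n + 2) <= ln ((n + 2) / (n + 1)), which is ln (1 + z) <= z at z =
    - 1 / (n + 2). *)
Lemma harmonic_le (R : realType) (n : nat) : (0 < n)%N ->
  \sum_(i < n) (i.+1%:R : R)^-1 <= 1 + ln n%:R.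
Proof.
case: n => // n _; elim: n => [|n IH].
  by rewrite big_ord_recl big_ord0 invr1 ln1.
rewrite big_ord_recr /= (le_trans (lerD IH (lexx _))) //.
rewrite -addrA lerD2l -lerBrDl -[ln n.+2%:R - _]opprB lerNr -ln_div ?posrE //.
have -> : n.+1%:R / n.+2%:R = 1 + - n.+2%:R^-1 :> R.
  have nz : n.+2%:R != 0 :> R by rewrite pnatr_eq0.
  by apply: (canLR (mulfK nz)); rewrite mulrBl mul1r mulVf // -[n.+2%:R]natr1 addrK.
by apply: le_ln1Dx; rewrite ltrN2 invf_lt1 ?ltr1n.
Qed.

(** * Guessing orders: sorting, merging and decoding *)

(** [g] is the position in a list sorted by [key]. Entries up to and including x have keys at most
    that of x, however ties are broken. *)
Lemma sorted_bijection d (K : orderType d) (X : finType) (key : X -> K) :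
  exists g : {ffun X -> 'I_#|X|}, bijective g /\
    forall x, (g x < #|[pred x' | (key x' <= key x)%O]|)%N.
Proof.
pose le := relpre key <=%O; pose s := sort le (enum X).
have le_total : total le by move=> x y; exact: le_total.
have le_trans : transitive le by move=> y x z; exact: le_trans.
have s_uniq : uniq s by rewrite sort_uniq enum_uniq.
have s_mem x : x \in s by rewrite mem_sort mem_enum.
have s_lt x : (index x s < #|X|)%N by rewrite cardE -(size_sort le) index_mem.
exists [ffun x => Ordinal (s_lt x)]; split.
  apply: inj_card_bij; last by rewrite card_ord.
  move=> x y; rewrite !ffunE => -[/(congr1 (nth x s))].
  by rewrite !nth_index.
move=> x; rewrite ffunE /=.
have <- : #|take (index x s).+1 s| = (index x s).+1.
  by rewrite (card_uniqP (take_uniq _ s_uniq)) size_takel ?index_mem.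
apply/subset_leq_card/subsetP => y; rewrite in_take // inE ltnS => le_yx.
rewrite -(nth_index x (s_mem y)) -[in leRHS](nth_index x (s_mem x)).
by apply: (sorted_leq_nth le_trans) => //;
  rewrite ?inE ?index_mem ?(sort_sorted le_total) // => z; exact: lexx.
Qed.

Lemma sorted_guessing d (K : orderType d) (X W : finType) (key : W -> X -> K) :
  exists G : guessing X W, forall x w,
    (rank G x w <= #|[pred x' | (key w x' <= key w x)%O]|)%N.
Proof.
have [g gP] := fin_all_exists (fun w => @sorted_bijection d K X (key w)).
have Gbij : is_guessing [ffun w => g w].
  by apply/asboolP => w; rewrite ffunE; case: (gP w).
by exists (Guessing Gbij) => x w; rewrite /rank /= ffunE; case: (gP w).
Qed.

Lemma guess_bij (X W : finType) (G : guessing X W) w : bijective (G w).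
Proof. by case: G => g /= /asboolP. Qed.

Lemma card_le_nat (T : finType) (A : {pred T}) (f : T -> nat) k :
  {in A &, injective f} -> (forall t, t \in A -> f t < k)%N -> (#|A| <= k)%N.
Proof.
move=> f_inj f_lt; case: (posnP k) => [k0|k_gt0].
  rewrite k0 leqn0; apply/eqP/eq_card0 => t; apply/negP => /f_lt.
  by rewrite k0.
case: k k_gt0 f_lt => // k _ f_lt.
rewrite -(card_in_imset (f := fun t => inord (f t) : 'I_k.+1)); last first.
  move=> t t' tA t'A /(congr1 val) /=.
  by rewrite !inordK ?f_lt //; exact: f_inj.
by rewrite (leq_trans (max_card _)) ?card_ord.
Qed.

Lemma card_rank_le (X W : finType) (G : guessing X W) w k :
  (#|[pred x | rank G x w <= k]| <= k)%N.
Proof.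
apply: (@card_le_nat _ _ (fun x => G w x)) => [x x' _ _ /val_inj|x] //.
exact: bij_inj (guess_bij G w) _ _.
Qed.

Lemma sum_rank_inv (R : realType) (X W : finType) (G : guessing X W) w :
  (0 < #|X|)%N ->
  \sum_x ((rank G x w)%:R : R)^-1 <= 1 + ln #|X|%:R.
Proof.
move=> X0; apply: le_trans (@harmonic_le R _ X0).
by rewrite (reindex (G w)) ?lexx //; apply: onW_bij; exact: guess_bij.
Qed.

Section FinMin.
Variables (R : realType) (T : finType) (t0 : T) (F : T -> R).

Lemma fin_min_le t : fin_min t0 F <= F t.
Proof. exact: bigmin_le. Qed.

Lemma le_fin_min c : (forall t, c <= F t) -> c <= fin_min t0 F.
Proof. by move=> cF; apply: le_bigmin. Qed.

Lemma fin_min_attained : exists t, fin_min t0 F = F t.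
Proof.
rewrite /fin_min; elim/big_ind: _ => [|x y [t ->] [t' ->]|t _].
- by exists t0.
- by rewrite /Order.min; case: ifP => _; [exists t|exists t'].
- by exists t.
Qed.
End FinMin.

Lemma card_exists_le (T I : finType) (p : I -> pred T) k :
  (forall i, #|p i| <= k)%N ->
  (#|[pred t | [exists i, p i t]]| <= #|I| * k)%N.
Proof.
move=> pk; rewrite -sum1_card big_mkcond /=.
apply: (@leq_trans (\sum_t \sum_i p i t)).
  apply: leq_sum => t _; rewrite inE; case: existsP => // -[i pit].
  by rewrite (bigD1 i) //= pit.
rewrite exchange_big /= -sum_nat_const; apply: leq_sum => i _.
apply: leq_trans (pk i); rewrite -sum1_card [leqRHS]big_mkcond /=.
by apply: leq_sum => t _; rewrite unfold_in; case: (p i t).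
Qed.

(** [h] rebuilds the side information of [G] from w and the missing m. An element sorted no later
    than x has, for some m', rank at most that of x at m; each m' allows at most that many
    elements. *)
Lemma guessing_merge (X V W M : finType) (h : W -> M -> V) (G : guessing X V) :
  (0 < #|M|)%N ->
  exists G' : guessing X W, forall x w m,
    (rank G' x w <= #|M| * rank G x (h w m))%N.
Proof.
move=> /card_gt0P[m0 _].
pose best w x := [arg min_(m < m0) rank G x (h w m)]%N.
have [G' G'P] := sorted_guessing (fun w x => rank G x (h w (best w x))).
exists G' => x w m; apply: leq_trans (G'P x w) _.
apply: leq_trans (card_exists_le
  (fun m' => card_rank_le G (h w m') (rank G x (h w m)))).
apply/subset_leq_card/subsetP => x'; rewrite !inE leEnat => le_x'x.
apply/existsP; exists (best w x'); apply: leq_trans le_x'x _.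
by rewrite /best; case: arg_minnP => // i _; apply.
Qed.

(** [feas w] collects the elements compatible with w. Their zero-based ranks share one residue mod
    c, so the quotients by c tell them apart. *)
Lemma guessing_decode (X V W : finType) (c : nat) (h : W -> V)
    (feas : W -> pred X) (G : guessing X V) :
  (forall w x x', feas w x -> feas w x' -> G (h w) x = G (h w) x' %[mod c]) ->
  exists G' : guessing X W, forall x w, feas w x ->
    (rank G' x w <= (G (h w) x %/ c).+1)%N.
Proof.
move=> feasP.
(* Zero-based ranks lie below |X|, so the default key puts every infeasible element last. *)
have [G' G'P] := sorted_guessing
  (fun w x => if feas w x then G (h w) x : nat else #|X|).
exists G' => x w wx; apply: leq_trans (G'P x w) _; rewrite wx.
apply: (@card_le_nat _ _ (fun x' => G (h w) x' %/ c)%N).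
  move=> x1 x2; rewrite !inE !leEnat.
  case: ifP => [w1 _|_]; last by rewrite leqNgt ltn_ord.
  case: ifP => [w2 _|_]; last by rewrite leqNgt ltn_ord.
  move=> eq_div; apply: (bij_inj (guess_bij G (h w))); apply: val_inj.
  by rewrite /= (divn_eq (G (h w) x1) c) (divn_eq (G (h w) x2) c) eq_div
    (feasP _ _ _ w1 w2).
move=> x'; rewrite inE leEnat.
case: ifP => [w' le_x'x|_]; last by rewrite leqNgt ltn_ord.
by rewrite ltnS leq_div2r.
Qed.

Lemma ex_injection (S T : finType) : (#|S| <= #|T|)%N ->
  exists f : S -> T, injective f.
Proof.
move=> le_ST; exists (fun s => enum_val (widen_ord le_ST (enum_rank s))).
by move=> s s' /enum_val_inj/(congr1 val)/= /val_inj/enum_rank_inj.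
Qed.

(** * Arimoto's sum and the optimal guessing order *)

Section Arimoto.
Variables (R : realType) (X Y : finType) (rho : R) (P : X * Y -> R).
Hypothesis rho_gt0 : 0 < rho.

(* [2 ^ (rho * H)] for the conditional Rényi entropy [H] of order
   [1 / (1 + rho)] *)
Definition arimoto : R :=
  \sum_y (\sum_x P (x, y) `^ (1 / (1 + rho))) `^ (1 + rho).

(** With a = 1 / (1 + rho), the rank of x is at most the number of x' with P(x', y) >= P(x, y),
    hence at most Z / P(x, y)^a, where Z sums all P(x', y)^a. The identity P = P^a (P^a)^rho then
    gives the bound. *)
Lemma guessing_le_arimoto : (forall xy, 0 <= P xy) ->
  exists G : guessing X Y,
    \sum_y \sum_x P (x, y) * (rank G x y)%:R `^ rho <= arimoto.
Proof.
move=> P0; have [G GP] := sorted_guessing (fun y x => - P (x, y)).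
exists G; apply: ler_sum => y _; set a := 1 / (1 + rho).
have r1 : 0 < 1 + rho by rewrite addr_gt0.
have a0 : 0 < a by rewrite divr_gt0.
set Z := \sum_x P (x, y) `^ a.
have Z0 : 0 <= Z by apply: sumr_ge0 => x _; exact: powR_ge0.
have -> : Z `^ (1 + rho) = \sum_x P (x, y) `^ a * Z `^ rho.
  by rewrite -mulr_suml powRD ?powRr1 // gt_eqF.
apply: ler_sum => x _; have := P0 (x, y); rewrite le_eqVlt => /predU1P[<-|Pxy].
  by rewrite mul0r mulr_ge0 ?powR_ge0.
have rank_le : (rank G x y)%:R * P (x, y) `^ a <= Z.
  apply: (@le_trans _ _ (\sum_(x' | P (x, y) <= P (x', y)) P (x, y) `^ a)).
    rewrite sumr_const -[leRHS]mulr_natl ler_wpM2r ?powR_ge0 // ler_nat.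
    apply: leq_trans (GP x y) _; apply/subset_leq_card/subsetP => x'.
    by rewrite !inE lerN2.
  rewrite /Z [leRHS](bigID (fun x' => P (x, y) <= P (x', y))) /=.
  rewrite -[leLHS]addr0 lerD //; last first.
    by apply: sumr_ge0 => x' _; exact: powR_ge0.
  by apply: ler_sum => x' le_xx'; apply: le_powR2 => //; exact: ltW.
have eqP : P (x, y) = P (x, y) `^ a * (P (x, y) `^ a) `^ rho.
  rewrite -powRrM -powRD; last by rewrite (gt_eqF Pxy) implybT.
  have -> : a + a * rho = 1 by rewrite /a; field; exact: lt0r_neq0.
  by rewrite powRr1 ?ltW.
rewrite {1}eqP -mulrA ler_wpM2l ?powR_ge0 // -powRM ?powR_ge0 //.
by rewrite mulrC le_powR2 ?(ltW rho_gt0) // mulr_ge0 ?powR_ge0.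
Qed.

(** Positivity lets [powR_renyi] recover the sum from its logarithm. *)
Lemma arimoto_gt0 : is_pmf P -> 0 < arimoto.
Proof.
move=> [P0 P1].
have sumP : \sum_xy P xy <> 0 by rewrite P1; apply/eqP; exact: oner_neq0.
have [[x y] /andP[_ Pxy]] := @psumr_neq0P R _ xpredT P (fun xy _ => P0 xy) sumP.
apply: (@lt_le_trans _ _ ((\sum_x P (x, y) `^ (1 / (1 + rho))) `^ (1 + rho))).
  apply: powR_gt0; rewrite (bigD1 x) //= ltr_pwDl ?powR_gt0 //.
  by apply: sumr_ge0 => x' _; exact: powR_ge0.
rewrite /arimoto [leRHS](bigD1 y) //= lerDl.
by apply: sumr_ge0 => y' _; exact: powR_ge0.
Qed.

(** At alpha = 1 / (1 + rho) the prefactor alpha / (1 - alpha) is 1 / rho, so the exponent is [log2]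
    of the sum. *)
Lemma powR_renyi : is_pmf P ->
  2 `^ (rho * renyi (1 / (1 + rho)) P) = arimoto.
Proof.
move=> pmfP; have r1 : 1 + rho != 0 by rewrite gt_eqF ?addr_gt0.
have ln2 : ln 2 != 0 :> R by rewrite gt_eqF // ln_gt0 // ltr1n.
rewrite /renyi /log2.
have -> : (1 / (1 + rho))^-1 = 1 + rho by rewrite div1r invrK.
rewrite -/arimoto mulrA.
have -> : rho * (1 / (1 + rho) / (1 - 1 / (1 + rho))) = 1.
  have -> : 1 - 1 / (1 + rho) = rho / (1 + rho) by field.
  by field; rewrite r1 gt_eqF.
by rewrite mul1r /powR pnatr_eq0 /= divfK // lnK // posrE arimoto_gt0.
Qed.

Lemma powR_renyi_sub (k : R) : is_pmf P -> 0 < k ->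
  2 `^ (rho * (renyi (1 / (1 + rho)) P - log2 k)) = k `^ (- rho) * arimoto.
Proof.
move=> pmfP k0; have ln2 : ln 2 != 0 :> R by rewrite gt_eqF // ln_gt0 // ltr1n.
have log2K : 2 `^ log2 k = k.
  by rewrite /log2 /powR pnatr_eq0 /= divfK // lnK.
have two0 : 2 != 0 :> R by rewrite pnatr_eq0.
rewrite mulrBr powRD; last by rewrite two0 implybT.
by rewrite (powR_renyi pmfP) mulrC -[in RHS]log2K -powRrM mulrN [log2 k * _]mulrC.
Qed.

End Arimoto.

(** [T] will be X paired with the hints in the converse, and X paired with the key in the direct
    part. *)
Lemma sum_powR_sum_le (R : realType) (Y T : finType) (rho K : R)
    (p L : Y -> T -> R) :
  0 < rho -> (forall y t, 0 <= p y t) -> (forall y t, 0 < L y t) ->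
  (forall y, \sum_t (L y t)^-1 <= K) ->
  \sum_y (\sum_t p y t `^ (1 / (1 + rho))) `^ (1 + rho) <=
  K `^ rho * \sum_y \sum_t p y t * L y t `^ rho.
Proof.
move=> rho0 p0 L0 LK; rewrite mulr_sumr; apply: ler_sum => y _.
apply: le_trans (powR_sum_le rho0 (p0 y) (L0 y)) _.
apply: ler_wpM2r.
  by apply: sumr_ge0 => t _; rewrite mulr_ge0 ?powR_ge0.
apply: le_powR2 => //; first exact: ltW.
by apply: sumr_ge0 => t _; rewrite invr_ge0 ltW.
Qed.

(** * Expectations and iterated sums *)

Lemma le_expectation (R : realType) (T : finType) (p f g : T -> R) :
  is_pmf p -> (forall t, f t <= g t) -> expectation p f <= expectation p g.
Proof. by move=> [p0 _] fg; apply: ler_sum => t _; rewrite ler_wpM2l. Qed.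

Lemma expectation_cst (R : realType) (T : finType) (p : T -> R) (c : R) :
  is_pmf p -> expectation p (fun=> c) = c.
Proof. by move=> [_ p1]; rewrite /expectation -mulr_suml p1 mul1r. Qed.

Lemma expectation_lt (R : realType) (T : finType) (p f g : T -> R) :
  is_pmf p -> (forall t, f t < g t) -> expectation p f < expectation p g.
Proof.
move=> [p0 p1] fg; rewrite -subr_gt0 /expectation -sumrB.
have sump : \sum_t p t <> 0 by rewrite p1; apply/eqP; exact: oner_neq0.
have [t /andP[_ pt]] := @psumr_neq0P R _ xpredT p (fun t _ => p0 t) sump.
rewrite (bigD1 t) //= ltr_pwDl // -?mulrBr ?mulr_gt0 ?subr_gt0 //.
by apply: sumr_ge0 => t' _; rewrite -mulrBr mulr_ge0 // subr_ge0 ltW.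
Qed.

Lemma sum_pair (R : realType) (S T : finType) (F : S * T -> R) :
  \sum_st F st = \sum_s \sum_t F (s, t).
Proof. by rewrite pair_bigA; apply: eq_bigr => -[]. Qed.

Lemma sum_pair_swap (R : realType) (X Y : finType) (F : X * Y -> R) :
  \sum_xy F xy = \sum_y \sum_x F (x, y).
Proof. by rewrite sum_pair exchange_big. Qed.

Lemma expectation_joint (R : realType) (X Y M1 M2 : finType) (P : X * Y -> R)
    (Q : X * Y -> M1 * M2 -> R) (F : (X * Y) * (M1 * M2) -> R) :
  expectation (joint P Q) F =
  expectation P (fun xy => expectation (Q xy) (fun m => F (xy, m))).
Proof.
rewrite /expectation /joint.
rewrite sum_pair; apply: eq_bigr => xy _ /=.
by rewrite mulr_sumr; apply: eq_bigr => m _; rewrite mulrA.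
Qed.

(** * Bounds for an arbitrary encoder *)

Section Converse.
Variables (R : realType) (X Y M1 M2 : finType) (rho : R) (P : X * Y -> R).
Variable Q : X * Y -> M1 * M2 -> R.
Hypotheses (rho_gt0 : 0 < rho) (pmfP : is_pmf P) (encQ : is_encoder Q).

Lemma joint_pmf : is_pmf (joint P Q).
Proof.
have [P0 P1] := pmfP; split=> [[xy m]|].
  by rewrite /joint /= mulr_ge0 //; case: (encQ xy).
have := expectation_joint P Q (fun=> 1).
rewrite /expectation (eq_bigr (joint P Q)) => [->|t _]; last by rewrite mulr1.
rewrite -[RHS]P1; apply: eq_bigr => xy _.
have [_ Q1] := encQ xy.
by rewrite (eq_bigr (Q xy)) ?Q1 ?mulr1 // => m _; rewrite mulr1.
Qed.

Lemma ambiguityB_attained : exists G : guessing X (Y * M1 * M2)%type,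
  ambiguityB rho P Q = expectation (joint P Q) (fun '((x, y), (m1, m2)) =>
    (rank G x (y, m1, m2))%:R `^ rho).
Proof. exact: fin_min_attained. Qed.

Lemma ambiguityB_ge1 : 1 <= ambiguityB rho P Q.
Proof.
apply: le_fin_min => G; rewrite -[leLHS](expectation_cst 1 joint_pmf).
apply: (le_expectation joint_pmf) => -[[x y] [m1 m2]].
by rewrite -[leLHS](powRr0 (rank G x (y, m1, m2))%:R) ler_powR ?ler1n ?ltW.
Qed.

Lemma ambiguityB_ge : (0 < #|X|)%N ->
  arimoto rho P <=
  ((#|M1| * #|M2|)%:R * (1 + ln #|X|%:R)) `^ rho * ambiguityB rho P Q.
Proof.
move=> X0; have [P0 P1] := pmfP.
have [G ->] := ambiguityB_attained.
have r1 : 0 < 1 + rho by rewrite addr_gt0.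
pose p y t := P (t.1, y) * Q (t.1, y) t.2.
pose L y (t : X * (M1 * M2)) : R := (rank G t.1 (y, t.2.1, t.2.2))%:R.
have p_ge0 y t : 0 <= p y t by rewrite mulr_ge0 //; case: (encQ (t.1, y)).
have L_gt0 y t : 0 < L y t by rewrite ltr0n.
have L_le y : \sum_t (L y t)^-1 <= (#|M1| * #|M2|)%:R * (1 + ln #|X|%:R).
  rewrite sum_pair exchange_big /= -card_prod mulr_natl -sumr_const.
  by apply: ler_sum => m _; rewrite /L /=; exact: sum_rank_inv.
(* Splitting the mass of (x, y) among the hints can only increase the sum: q <= q^a for q in [0, 1],
   as a = 1 / (1 + rho) <= 1. *)
have arimoto_le : arimoto rho P <=
    \sum_y (\sum_t p y t `^ (1 / (1 + rho))) `^ (1 + rho).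
  apply: ler_sum => y _; apply: le_powR2; first exact: ltW.
    by apply: sumr_ge0 => x _; exact: powR_ge0.
  rewrite sum_pair; apply: ler_sum => x _; have [Q0 Q1] := encQ (x, y).
  rewrite (eq_bigr (fun m => P (x, y) `^ (1 / (1 + rho)) *
     Q (x, y) m `^ (1 / (1 + rho)))) => [|m _]; last by rewrite -powRM.
  rewrite -mulr_sumr ler_peMr ?powR_ge0 // -[leLHS]Q1; apply: ler_sum => m _.
  have := Q0 m; rewrite le_eqVlt => /predU1P[<-|Qm]; first exact: powR_ge0.
  apply: ger1_powR; first by rewrite Qm -[leRHS]Q1 (bigD1 m) //= lerDl sumr_ge0.
  by rewrite div1r invf_le1 // lerDl ltW.
apply: le_trans arimoto_le _.
apply: le_trans (sum_powR_sum_le rho_gt0 p_ge0 L_gt0 L_le) _.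
rewrite expectation_joint /expectation sum_pair_swap.
rewrite le_eqVlt; apply/orP; left; apply/eqP; congr (_ * _).
apply: eq_bigr => y _.
rewrite sum_pair /=; apply: eq_bigr => x _; rewrite mulr_sumr.
by apply: eq_bigr => -[m1 m2] _; rewrite mulrA.
Qed.

(** Eve may ignore her hint and use a guessing order that is good for Y alone. *)
Lemma ambiguityE_le_arimoto : ambiguityE rho P Q <= arimoto rho P.
Proof.
have [P0 P1] := pmfP.
have [G GP] := guessing_le_arimoto rho_gt0 P0; apply: le_trans GP.
(* Merging over [unit] costs a factor 1 and turns an order given [h w] into one given [w]. *)
have lift_guessing (W : finType) (h : W -> Y) : exists G' : guessing X W,
    forall x w, (rank G' x w <= rank G x (h w))%N.
  have cardu : (0 < #|unit : finType|)%N by rewrite card_unit.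
  have [G' G'P] := guessing_merge (fun w (_ : unit) => h w) G cardu.
  by exists G' => x w; have := G'P x w tt; rewrite card_unit mul1n.
have [G1 G1P] := lift_guessing (Y * M1)%type fst.
have [G2 G2P] := lift_guessing (Y * M2)%type fst.
apply: le_trans (fin_min_le _ _ (G1, G2)) _ => /=.
rewrite -(sum_pair_swap (fun xy => P xy * (rank G xy.1 xy.2)%:R `^ rho)).
rewrite expectation_joint; apply: le_expectation => // -[x y] /=.
rewrite -[leRHS](expectation_cst _ (encQ (x, y))).
apply: le_expectation => // -[m1 m2].
by rewrite ge_min le_powR2 ?(ltW rho_gt0) ?ler_nat ?(G1P x (y, m1)).
Qed.

(** Merging Bob's order over the missing hint costs |M2| for [G1] and |M1| for [G2]. Eve pays the
    smaller of the two, so the smaller factor suffices. *)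
Lemma ambiguityE_le_ambiguityB : (0 < #|M1|)%N -> (0 < #|M2|)%N ->
  ambiguityE rho P Q <=
  Num.min (#|M1|%:R `^ rho) (#|M2|%:R `^ rho) * ambiguityB rho P Q.
Proof.
move=> M10 M20.
have [G ->] := ambiguityB_attained.
have [G1 G1P] := guessing_merge (fun (w : Y * M1) m => (w.1, w.2, m)) G M20.
have [G2 G2P] := guessing_merge (fun (w : Y * M2) m => (w.1, m, w.2)) G M10.
apply: le_trans (fin_min_le _ _ (G1, G2)) _ => /=.
rewrite {2}/expectation mulr_sumr; apply: ler_sum => -[[x y] [m1 m2]] _.
rewrite mulrCA; apply: ler_wpM2l; first by have [+ _] := joint_pmf; apply.
have powM (M : finType) k : (#|M|%:R `^ rho * k%:R `^ rho = (#|M| * k)%:R `^ rho :> R).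
  by rewrite natrM powRM.
rewrite minr_pMl ?powR_ge0 // !powM.
have le_rank k k' : (k <= k')%N -> k%:R `^ rho <= k'%:R `^ rho :> R.
  by move=> ?; rewrite le_powR2 ?(ltW rho_gt0) // ler_nat.
rewrite le_min !ge_min (le_rank _ _ (G2P x (y, m2) m1)) orbT.
by rewrite (le_rank _ _ (G1P x (y, m1) m2)).
Qed.

End Converse.

(** * Encoders driven by a uniform key *)

Section UniformEncoder.
Variables (R : realType) (X Y M1 M2 U : finType).
Variable f : U -> X * Y -> M1 * M2.
Hypothesis U_gt0 : (0 < #|U|)%N.

(** The law of [f u xy] for a uniform u; counting the keys allows several of them to give the same
    hints. *)
Definition uniform_encoder (xy : X * Y) (m : M1 * M2) : R :=
  #|U|%:R^-1 * \sum_u (f u xy == m)%:R.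

Lemma expectation_uniform_encoder xy (F : M1 * M2 -> R) :
  expectation (uniform_encoder xy) F = #|U|%:R^-1 * \sum_u F (f u xy).
Proof.
rewrite /expectation /uniform_encoder.
under eq_bigr do rewrite -mulrA mulr_suml.
rewrite -mulr_sumr exchange_big; congr (_ * _); apply: eq_bigr => u _ /=.
rewrite (bigD1 (f u xy)) //= eqxx mul1r big1 ?addr0 // => m.
by rewrite eq_sym => /negPf->; rewrite mul0r.
Qed.

Lemma uniform_encoder_is_encoder : is_encoder uniform_encoder.
Proof.
move=> xy; split=> [m|].
  by rewrite mulr_ge0 ?invr_ge0 // sumr_ge0.
have := expectation_uniform_encoder xy (fun=> 1).
rewrite /expectation (eq_bigr (uniform_encoder xy)) => [->|m _]; last exact: mulr1.
by rewrite sumr_const mulVf // pnatr_eq0 -lt0n.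
Qed.

End UniformEncoder.

(** * Performance of the one-time pad encoder *)

Section Direct.
Variables (R : realType) (X Y M1 M2 : finType) (rho : R) (P : X * Y -> R).
Hypotheses (rho_gt0 : 0 < rho) (pmfP : is_pmf P).
Variables (n c1 c2 : nat).
Hypotheses (c1_gt0 : (0 < c1)%N) (c2_gt0 : (0 < c2)%N).
(** Here cs is n + 1, so that [U] carries the addition of Z/cs. *)
Let U : finType := 'I_n.+1.
Variables (i1 : U * 'I_c1 -> M1) (i2 : U * 'I_c2 -> M2).
Variables v : X * Y -> U * 'I_c1 * 'I_c2.

(* One-time pad: [u] is a uniform key that hides the first component of the
   description [v xy] from an observer of either hint alone. *)
Definition padded_hints (u : U) (xy : X * Y) : M1 * M2 :=
  (i1 ((v xy).1.1 + u, (v xy).1.2), i2 (u, (v xy).2)).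

Let Q : X * Y -> M1 * M2 -> R := uniform_encoder R padded_hints.

Lemma le_ambiguityE_padded : (0 < #|X|)%N ->
  arimoto rho P <=
  ((c1 + c2)%:R * (1 + ln #|X|%:R)) `^ rho * ambiguityE rho P Q.
Proof.
move=> X_gt0; have [P0 _] := pmfP.
have r1 : 0 < 1 + rho by rewrite addr_gt0.
have lnX : 0 <= 1 + ln #|X|%:R :> R by rewrite addr_ge0 // ln_ge0 ?ler1n.
have [[G1 G2] ->] : exists G : guessing X (Y * M1)%type * guessing X (Y * M2)%type,
    ambiguityE rho P Q = expectation (joint P Q) (fun '((x, y), (m1, m2)) =>
      Num.min ((rank G.1 x (y, m1))%:R `^ rho) ((rank G.2 x (y, m2))%:R `^ rho)).
  rewrite /ambiguityE.
  have [[G1 G2] eqG] := fin_min_attained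
    (enum_guessing X (Y * M1)%type, enum_guessing X (Y * M2)%type)
    (fun '(G1, G2) => expectation (joint P Q) (fun '((x, y), (m1, m2)) =>
      Num.min ((rank G1 x (y, m1))%:R `^ rho) ((rank G2 x (y, m2))%:R `^ rho))).
  by exists (G1, G2).
pose r1_ y (t : X * U) : R := (rank G1 t.1 (y, (padded_hints t.2 (t.1, y)).1))%:R.
pose r2_ y (t : X * U) : R := (rank G2 t.1 (y, (padded_hints t.2 (t.1, y)).2))%:R.
pose L y t := Num.min (r1_ y t) (r2_ y t).
have r1_gt0 y t : 0 < r1_ y t by rewrite ltr0n.
have r2_gt0 y t : 0 < r2_ y t by rewrite ltr0n.
have L_gt0 y t : 0 < L y t by rewrite lt_min r1_gt0 r2_gt0.
have le_pick (I : finType) (k : I -> nat) i : (k i)%:R^-1 <= \sum_j (k j)%:R^-1 :> R.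
  by rewrite (bigD1 i) //= lerDl sumr_ge0 // => j _; rewrite invr_ge0.
have sum_r1 y : \sum_t (r1_ y t)^-1 <= (n.+1 * c1)%:R * (1 + ln #|X|%:R).
  apply: (@le_trans _ _ (\sum_x \sum_(a : U * 'I_c1) (rank G1 x (y, i1 a))%:R^-1)).
    rewrite sum_pair; apply: ler_sum => x _; rewrite sum_pair.
    (* For fixed x, the shift u -> vs + u permutes Z/cs. The hint actually sent is then one of the
       c1 hints with first component vs + u. *)
    rewrite [leRHS](reindex_inj (addrI (v (x, y)).1.1)) /=.
    apply: ler_sum => u _; rewrite /r1_ /r2_ /padded_hints /=.
    exact: (le_pick _ (fun b => rank G1 x (y, i1 ((v (x, y)).1.1 + u, b)))).
  rewrite exchange_big /=; apply: (@le_trans _ _ (\sum_(a : U * 'I_c1) (1 + ln #|X|%:R))).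
    by apply: ler_sum => a _; exact: sum_rank_inv.
  by rewrite sumr_const card_prod !card_ord mulr_natl.
have sum_r2 y : \sum_t (r2_ y t)^-1 <= (n.+1 * c2)%:R * (1 + ln #|X|%:R).
  apply: (@le_trans _ _ (\sum_x \sum_(a : U * 'I_c2) (rank G2 x (y, i2 a))%:R^-1)).
    rewrite sum_pair; apply: ler_sum => x _; rewrite sum_pair.
    apply: ler_sum => u _; rewrite /r1_ /r2_ /padded_hints /=.
    exact: (le_pick _ (fun b => rank G2 x (y, i2 (u, b)))).
  rewrite exchange_big /=; apply: (@le_trans _ _ (\sum_(a : U * 'I_c2) (1 + ln #|X|%:R))).
    by apply: ler_sum => a _; exact: sum_rank_inv.
  by rewrite sumr_const card_prod !card_ord mulr_natl.
have sum_L y : \sum_t (L y t)^-1 <= n.+1%:R * ((c1 + c2)%:R * (1 + ln #|X|%:R)).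
  have -> : n.+1%:R * ((c1 + c2)%:R * (1 + ln #|X|%:R)) =
      (n.+1 * c1)%:R * (1 + ln #|X|%:R) + (n.+1 * c2)%:R * (1 + ln #|X|%:R) :> R.
    by rewrite !natrM natrD; ring.
  apply: le_trans (lerD (sum_r1 y) (sum_r2 y)); rewrite -big_split /=.
  apply: ler_sum => t _; rewrite /L /Num.min.
  by case: ifP => _; rewrite ?lerDl ?lerDr invr_ge0 ltW.
have := sum_powR_sum_le (p := fun y (t : X * U) => P (t.1, y)) rho_gt0
  (fun y t => P0 _) L_gt0 sum_L.
(* Each x is repeated n + 1 times. Of the resulting (n + 1)^(1 + rho), the power rho cancels against
   K^rho and the remaining factor yields the 1 / (n + 1) of the law of u. *)
have -> : \sum_y (\sum_(t : X * U) P (t.1, y) `^ (1 / (1 + rho))) `^ (1 + rho) =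
    n.+1%:R `^ rho * (n.+1%:R * arimoto rho P).
  rewrite mulrA; have -> : n.+1%:R `^ rho * n.+1%:R = n.+1%:R `^ (1 + rho) :> R.
    by rewrite mulrC powRD ?powRr1 // gt_eqF.
  rewrite /arimoto mulr_sumr; apply: eq_bigr => y _.
  rewrite -powRM ?sumr_ge0 //; last by move=> x _; exact: powR_ge0.
  rewrite sum_pair /= mulr_sumr; congr (_ `^ _); apply: eq_bigr => x _.
  by rewrite sumr_const card_ord mulr_natl.
have K_ge0 : 0 <= (c1 + c2)%:R * (1 + ln #|X|%:R) :> R by rewrite mulr_ge0.
rewrite (powRM _ (ler0n R n.+1) K_ge0) -mulrA ler_pM2l ?powR_gt0 ?ltr0n //.
rewrite mulrC -ler_pdivlMr ?ltr0n // => /le_trans; apply.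
rewrite -mulrA ler_wpM2l ?powR_ge0 // expectation_joint.
rewrite [leRHS]/expectation sum_pair_swap mulrC mulr_sumr.
apply: ler_sum => y _; rewrite sum_pair mulr_sumr; apply: ler_sum => x _ /=.
rewrite -mulr_sumr mulrCA ler_wpM2l //.
rewrite expectation_uniform_encoder card_ord ler_wpM2l ?invr_ge0 //.
apply: ler_sum => u _ /=.
by rewrite le_min !le_powR2 ?ge_min ?lexx ?orbT ?(ltW rho_gt0) ?(ltW (L_gt0 y (x, u))).
Qed.

Variable G : guessing X Y.
Hypotheses (i1_inj : injective i1) (i2_inj : injective i2).
Hypothesis v_mod : forall x x' y, v (x, y) = v (x', y) ->
  G y x = G y x' %[mod n.+1 * c1 * c2].
Hypothesis G_le :
  \sum_y \sum_x P (x, y) * (rank G x y)%:R `^ rho <= arimoto rho P.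

(** M2 reveals u and v2; subtracting u, M1 reveals vs and v1. The elements compatible with both
    hints thus have congruent ranks, and [guessing_decode] applies. *)
Lemma ambiguityB_padded_lt :
  ambiguityB rho P Q < 1 + (2 / (n.+1 * c1 * c2)%:R) `^ rho * arimoto rho P.
Proof.
set c := (n.+1 * c1 * c2)%N; have c_gt0 : (0 < c)%N by rewrite !muln_gt0 c1_gt0 c2_gt0.
have [P0 P1] := pmfP.
pose feas (w : Y * M1 * M2) x := [exists u, padded_hints u (x, w.1.1) == (w.1.2, w.2)].
have feas_mod w x x' : feas w x -> feas w x' -> G w.1.1 x = G w.1.1 x' %[mod c].
  move=> /existsP[u /eqP eu] /existsP[u' /eqP]; rewrite -eu /padded_hints.
  move=> [/i1_inj e12 /i2_inj e34]; apply: v_mod.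
  have [e3 e4] : u' = u /\ (v (x', w.1.1)).2 = (v (x, w.1.1)).2 by case: e34.
  have e2 : (v (x', w.1.1)).1.2 = (v (x, w.1.1)).1.2 := congr1 snd e12.
  have := congr1 fst e12; rewrite e3 => /addIr/= e1.
  by move: (v (x, w.1.1)) (v (x', w.1.1)) e1 e2 e4 => [[a b] d] [[a' b'] d'] /= -> -> ->.
have [G' G'P] := guessing_decode feas_mod.
apply: le_lt_trans (fin_min_le _ _ G') _; rewrite expectation_joint.
apply: (@lt_le_trans _ _ (expectation P
  (fun xy => 1 + (2 / c%:R) `^ rho * (rank G xy.1 xy.2)%:R `^ rho))); last first.
  rewrite /expectation; under eq_bigr do rewrite mulrDr mulr1 mulrCA.
  rewrite big_split /= P1 lerD2l -mulr_sumr ler_wpM2l ?powR_ge0 //.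
  by rewrite sum_pair_swap.
apply: expectation_lt => // -[x y].
rewrite expectation_uniform_encoder.
apply: (@le_lt_trans _ _ ((G y x %/ c).+1%:R `^ rho)).
  rewrite card_ord ler_pdivrMl ?ltr0n //.
  rewrite mulr_natl -[X in _ *+ X](card_ord n.+1) -sumr_const.
  apply: ler_sum => u _; rewrite le_powR2 ?(ltW rho_gt0) ?ler_nat //=.
  by apply: (G'P x (y, _, _)); apply/existsP; exists u.
(* For a zero-based rank g < c the first guess is right, and the positive second term makes the
   bound strict. For g >= c, floor (g / c) + 1 <= 2 g / c, and the summand 1 gives strictness. *)
have [lt_c|ge_c] := ltnP (G y x) c.
  by rewrite divn_small // powR1 ltrDl mulr_gt0 ?powR_gt0 ?divr_gt0 ?ltr0n.
rewrite -powRM ?divr_ge0 //; apply: (@le_lt_trans _ _ ((2 / c%:R * (rank G x y)%:R) `^ rho)); last first.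
  by rewrite ltrDr.
rewrite le_powR2 ?(ltW rho_gt0) //.
rewrite mulrAC ler_pdivlMr ?ltr0n // -!natrM ler_nat /rank.
have := leq_trunc_div (G y x) c; rewrite mulSn mulnS; lia.
Qed.

End Direct.

Theorem theorem1 (R : realType) (X Y M1 M2 : finType) (rho : R)
    (P : X * Y -> R)
    (hrho : 0 < rho)
    (hX : (0 < #|X|)%N) (hY : (0 < #|Y|)%N)
    (hM1 : (0 < #|M1|)%N) (hM2 : (0 < #|M2|)%N)
    (hP : is_pmf P) :
  let H := renyi (1 / (1 + rho)) P in
  (forall cs c1 c2 : nat,
     (0 < cs)%N -> (0 < c1)%N -> (0 < c2)%N ->
     (cs <= minn #|M1| #|M2|)%N ->
     (c1 <= #|M1| %/ cs)%N ->
     (c2 <= #|M2| %/ cs)%N ->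
     exists Q : X * Y -> M1 * M2 -> R,
       [/\ is_encoder Q,
           ambiguityB rho P Q <
             1 + 2 `^ (rho * (H - log2 (cs * c1 * c2)%:R + 1))
         & ambiguityE rho P Q >=
             (1 + ln #|X|%:R) `^ (- rho) *
             2 `^ (rho * (H - log2 (c1 + c2)%:R))])
  /\
  (forall Q : X * Y -> M1 * M2 -> R, is_encoder Q ->
     ambiguityB rho P Q >=
       Num.max ((1 + ln #|X|%:R) `^ (- rho) *
                2 `^ (rho * (H - log2 (#|M1| * #|M2|)%:R))) 1
     /\
     ambiguityE rho P Q <=
       Num.min (Num.min (#|M1|%:R `^ rho) (#|M2|%:R `^ rho) *
                  ambiguityB rho P Q)
               (2 `^ (rho * H))).
Proof.
move=> H; have lnX : 0 < 1 + ln #|X|%:R :> R by rewrite ltr_pwDl // ln_ge0 // ler1n.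
(* Common form of both lower bounds: k is |M1| |M2| for Bob and c1 + c2 for Eve. *)
have lower (k : nat) (A : R) : (0 < k)%N ->
    arimoto rho P <= (k%:R * (1 + ln #|X|%:R)) `^ rho * A ->
    (1 + ln #|X|%:R) `^ (- rho) * 2 `^ (rho * (H - log2 k%:R)) <= A.
  move=> k0 leA; rewrite powR_renyi_sub ?ltr0n // mulrA -powRM ?(ltW lnX) //.
  by rewrite powRN [_ * k%:R]mulrC ler_pdivrMl // powR_gt0 // mulr_gt0 ?ltr0n.
split=> [[//|n] c1 c2 _ c1_gt0 c2_gt0 _ le_c1 le_c2|Q encQ]; last first.
  rewrite ge_max le_min; split; apply/andP; split.
  - by apply: lower; rewrite ?muln_gt0 ?hM1 //; exact: ambiguityB_ge.
  - exact: ambiguityB_ge1.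
  - exact: ambiguityE_le_ambiguityB.
  - by rewrite powR_renyi //; exact: ambiguityE_le_arimoto.
have [P0 _] := hP.
have [G G_le] := guessing_le_arimoto hrho P0.
(* c1 <= floor (|M1| / cs) means cs c1 <= |M1|, so the pairs fit into M1; likewise for M2. *)
have [i1 i1_inj] : exists i1 : 'I_n.+1 * 'I_c1 -> M1, injective i1.
  by apply: ex_injection; rewrite card_prod !card_ord mulnC -leq_divRL.
have [i2 i2_inj] : exists i2 : 'I_n.+1 * 'I_c2 -> M2, injective i2.
  by apply: ex_injection; rewrite card_prod !card_ord mulnC -leq_divRL.
pose V : finType := ('I_n.+1 * 'I_c1 * 'I_c2)%type.
have cardV : #|V| = (n.+1 * c1 * c2)%N by rewrite !card_prod !card_ord.
have V_gt0 : (0 < #|V|)%N by rewrite cardV !muln_gt0 c1_gt0.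
(* The zero-based rank modulo |V| = cs c1 c2, read as a triple through the enumeration of [V]. *)
pose v xy : V := enum_val (Ordinal (ltn_pmod (G xy.2 xy.1) V_gt0)).
have v_mod x x' y : v (x, y) = v (x', y) -> G y x = G y x' %[mod n.+1 * c1 * c2].
  by move=> /enum_val_inj/(congr1 val) /=; rewrite cardV.
exists (uniform_encoder R (padded_hints i1 i2 v)).
split.
- by apply: uniform_encoder_is_encoder; rewrite card_ord.
- set c := (n.+1 * c1 * c2)%N; have c_gt0 : 0 < c%:R :> R.
    by rewrite ltr0n !muln_gt0 c1_gt0.
  (* The + 1 in the exponent is the factor 2^rho that pays for rounding. *)
  have -> : 2 `^ (rho * (H - log2 c%:R + 1)) =
      (2 / c%:R) `^ rho * arimoto rho P.
    rewrite mulrDr mulr1 powRD ?pnatr_eq0 ?implybT // powR_renyi_sub //.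
    by rewrite powRM ?invr_ge0 ?ltW // -powR_inv1 ?ltW // -powRrM mulN1r mulrC mulrA.
  exact: (ambiguityB_padded_lt _ _ _ _ i1_inj i2_inj v_mod).
- apply: lower; first by rewrite addn_gt0 c1_gt0.
  exact: le_ambiguityE_padded.
Qed.
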